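(* Let $K$ be a field of prime characteristic $p$, $S=K[x_1,\ldots,x_n]$ the standard graded polynomial ring, and $I\subsetneq S$ a graded ideal. Throughout, $q$ denotes a power of $p$, i.e. $q=p^e$ with $e\geq 0$ an integer. Then the following hold. (1) $\mathrm{v}(I^{[q]})\geq q\,\mathrm{v}(I)$ for all $q\geq 1$, and hence $\left\{\frac{\mathrm{v}(I^{[q]})}{q}\right\}_{q=p^e}$ is a non-decreasing sequence in $q$. (2) The limit $\lim_{q\to\infty}\frac{\mathrm{v}(I^{[q]})}{q}$ exists (as a finite real number). (3) If $I$ is an unmixed monomial ideal, then $\mathrm{v}(I^{[q]})=q\,\mathrm{v}(I)+(q-1)\,\mathrm{ht}(I)$ for all $q\geq 1$.
   Context: The $q$-th Frobenius power of $I$ is $I^{[q]}=(a^q : a\in I)$. $S_d$ denotes the degree-$d$ component of $S$, and $\mathrm{Ass}(I)$ the set of associated primes of $S/I$. For a proper graded ideal $I$ the v-number is $\mathrm{v}(I)=\min\{d\ge 0\mid \exists f\in S_d \text{ and } \mathfrak{p}\in\mathrm{Ass}(I) \text{ with } I:f=\mathfrak{p}\}$. The height $\mathrm{ht}(I)$ (respectively big height $\mathrm{bight}(I)$) is the minimum (respectively maximum) of the heights of the associated primes of $I$; $I$ is unmixed if $\mathrm{ht}(I)=\mathrm{bight}(I)$. The limit is taken along $q=p^e$, $e\to\infty$. *)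

(* Defs.v *)
(* mpoly is imported first: in the other order its notations are rejected.    *)
From HB Require Import structures.
From mathcomp Require Import all_boot all_order all_algebra.
From mathcomp Require Import mpoly.
From mathcomp Require Import all_classical.

Set Implicit Arguments.
Unset Strict Implicit.
Unset Printing Implicit Defensive.

Import Order.TTheory GRing.Theory.

Local Open Scope classical_set_scope.
Local Open Scope ring_scope.

(* Least and greatest elements of a set of natural numbers, with default 0    *)
(* when there is none.                                                        *)
Definition nat_min (A : set nat) : nat := xget 0%N (A `&` lbound A).
Definition nat_max (A : set nat) : nat := xget 0%N (A `&` ubound A).

Section Ideals.
Context {A : comNzRingType}.
Implicit Types (I P G : set A) (f : A).

(* idealr_closed includes 1 \notin I. *)
Definition is_proper_ideal I : Prop := idealr_closed [pred f in I].

Definition is_prime I : Prop := is_proper_ideal I /\ prime_idealr_closed [pred f in I].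

Definition ideal_gen G : set A :=
  [set f | exists s : seq (A * A),
     (forall x, x \in s -> G x.2) /\ f = \sum_(x <- s) x.1 * x.2].

Definition colon I f : set A := [set g | I (g * f)].

(* Associated primes of the module A / I: I : f is the annihilator of the     *)
(* class of f.                                                                *)
Definition Ass I : set (set A) :=
  [set P | is_prime P /\ exists f, colon I f = P].

Definition frobenius_power I (q : nat) : set A :=
  ideal_gen [set a ^+ q | a in I].

(* There are primes C 0 < C 1 < ... < C r = P. *)
Definition prime_chain (r : nat) P : Prop :=
  exists C : nat -> set A,
    [/\ forall i, (i <= r)%N -> is_prime (C i),
        forall i, (i < r)%N -> C i `<` C i.+1
      & C r = P].

(* The supremum is taken in nat; the default 0 would be reached only for a    *)
(* prime of infinite height.                                                  *)
Definition prime_height P : nat := supremum 0%N [set r | prime_chain r P].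

Definition ht I : nat := nat_min [set prime_height P | P in Ass I].
Definition bight I : nat := nat_max [set prime_height P | P in Ass I].

Definition is_unmixed I : Prop := ht I = bight I.

End Ideals.

Section PolynomialIdeals.
Context {n : nat} {K : fieldType}.
Implicit Types I : set {mpoly K[n]}.

Definition is_graded I : Prop := forall f d, I f -> I (pihomog mdeg d f).

Definition is_monomial_ideal I : Prop :=
  exists M : set 'X_{1..n}, I = ideal_gen [set 'X_[K, m] | m in M].

Definition v_number I : nat :=
  nat_min [set d | exists (f : {mpoly K[n]}) (P : set {mpoly K[n]}),
    [/\ f \is d.-homog, Ass I P & colon I f = P]].

End PolynomialIdeals.

(* Main.v *)
Require Import Defs.
From HB Require Import structures.
From mathcomp Require Import all_boot all_order all_algebra.
From mathcomp Require Import mpoly.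
From mathcomp Require Import all_classical all_reals all_analysis.

(** Let S = K[x_1, ..., x_n]. The main tool is the flatness of the Frobenius
    endomorphism of S, used in the following concrete form. A K^q-linear
    functional phi on K with values in K^q and a monomial m with exponents < q
    give a Cartier map: take the part of f in the coset q N^n + m of exponents,
    apply phi to the coefficients and extract q-th roots. Cartier maps T are
    additive, satisfy T (a^q f) = a T f, and finitely many of them determine any
    given f as a combination of the (T f)^q ([cartier_expand]). Hence f lies in
    I^[q] iff all T f lie in I, which gives I^[q] : f^q = (I : f)^[q], and shows
    that P^[q] is P-primary when P is prime.

    Lower bound. If I^[q] : f = P is prime, then P is up to radical the
    intersection of finitely many I : T f, so P = I : T f for a single T
    ([colon_frobenius_power_prime]). If f is homogeneous, then so is T f, and
    deg f = q deg (T f) + deg m. Hence v(I^[q]) >= q v(I); applied to I^[q] and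
    the exponent p this gives monotonicity of v(I^[q]) / q.

    Existence of the limit. It remains to bound v(I^[q]) / q. Fix homogeneous f
    and g with I : f = P prime and P^[p] : g = P. From I^[q] : h = P one gets
    I^[pq] : h^p g = P^[p] : g = P, so there are elements of degree at most a
    constant times q. That f and g exist (so that v-numbers are minima over
    nonempty sets) is the usual argument: a maximal colon ideal by a homogeneous
    element outside a graded ideal is prime. Maximal elements exist because S is
    noetherian, which follows from Dickson's lemma on leading monomials.

    Unmixed monomial ideals. Every associated prime is generated by a set A of
    variables, and #|A| = ht(I). If I : f = P_A, then multiplying f^q by the
    (q-1)-st power of the product of the variables of A gives an element with
    colon ideal P_A; this bounds v(I^[q]) above. Conversely, when
    I^[q] : f = P_A = I : T f, the monomial m attached to T has exponent q - 1 at
    each variable of A, since x_i f lies in I^[q] and T f does not lie in I; so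
    deg m >= (q - 1) ht(I).

    That the height of P_A is #|A| needs the dimension of S: a strictly
    increasing chain of primes C_0, ..., C_r has r <= n. For r > n, elements
    a_i in C_i \ C_(i-1) satisfy a polynomial relation over K by counting
    dimensions, and such a relation is contradicted by walking up the chain
    ([prime_chain_independent]). *)

Set Implicit Arguments.
Unset Strict Implicit.
Unset Printing Implicit Defensive.

Import Order.TTheory GRing.Theory Num.Theory.
Import numFieldNormedType.Exports.

Local Open Scope classical_set_scope.
Local Open Scope ring_scope.

(** * Ideals and Frobenius powers *)

Section IdealTheory.
Context {A : comNzRingType}.
Implicit Types (I J P Q : set A) (f g h : A).

(** Contrary to [idealr_closed], the unit ideal is allowed: a colon ideal, or an
    ideal generated by a set, has to be handled before it is known to be
    proper. *)
Definition is_ideal I : Prop :=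
  I 0 /\ forall a u v, I u -> I v -> I (a * u + v).

Lemma is_proper_idealP I : is_proper_ideal I <-> is_ideal I /\ ~ I 1.
Proof.
split.
  case; rewrite !inE => I0 I1 Icl; split=> [|I1']; last first.
    by move/negP: I1; apply; rewrite inE.
  split=> // a u v Iu Iv; have := Icl a u v.
  by rewrite !inE; apply.
case=> -[I0 Icl] I1; split; rewrite ?inE //.
  by apply/negP; rewrite inE.
by move=> a u v; rewrite !inE; apply: Icl.
Qed.

Lemma is_primeP P :
  is_prime P <->
  [/\ is_ideal P, ~ P 1 & forall u v, P (u * v) -> P u \/ P v].
Proof.
split.
  case=> /is_proper_idealP[Pid P1] Ppr; split=> // u v Puv.
  have := Ppr u v; rewrite !inE => /(_ Puv) /orP.
  by rewrite !inE.
case=> Pid P1 Ppr; split; first exact/is_proper_idealP.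
by move=> u v; rewrite !inE => /Ppr[]Pu; apply/orP; [left|right]; rewrite !inE.
Qed.

Lemma proper_ideal_ideal I : is_proper_ideal I -> is_ideal I.
Proof. by case/is_proper_idealP. Qed.

Lemma prime_ideal P : is_prime P -> is_ideal P.
Proof. by case/is_primeP. Qed.

Section Closure.
Variables (I : set A) (Iid : is_ideal I).

Lemma ideal_zero : I 0. Proof. by case: Iid. Qed.

Lemma ideal_add f g : I f -> I g -> I (f + g).
Proof. by move=> If Ig; case: Iid => _ /(_ 1 f g If Ig); rewrite mul1r. Qed.

Lemma ideal_mull g f : I f -> I (g * f).
Proof. by move=> If; case: Iid => I0 /(_ g f 0 If I0); rewrite addr0. Qed.

Lemma ideal_mulr g f : I f -> I (f * g).
Proof. by rewrite mulrC; exact: ideal_mull. Qed.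

Lemma ideal_opp f : I f -> I (- f).
Proof. by rewrite -mulN1r; exact: ideal_mull. Qed.

Lemma ideal_sub f g : I f -> I g -> I (f - g).
Proof. by move=> If Ig; apply: ideal_add => //; exact: ideal_opp. Qed.

Lemma ideal_sum (T : eqType) (s : seq T) (F : T -> A) :
  (forall x, x \in s -> I (F x)) -> I (\sum_(x <- s) F x).
Proof.
move=> IF; rewrite big_seq; elim/big_ind: _ => //; first exact: ideal_zero.
exact: ideal_add.
Qed.

End Closure.

Lemma ideal_genI G f : G f -> @ideal_gen A G f.
Proof.
move=> Gf; exists [:: (1, f)]; rewrite big_seq1 mul1r; split=> // x.
by rewrite inE => /eqP->.
Qed.

Lemma ideal_gen_ideal G : is_ideal (@ideal_gen A G).
Proof.
split; first by exists [::]; rewrite big_nil.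
move=> a _ _ [s [Gs ->]] [t [Gt ->]].
exists ([seq (a * x.1, x.2) | x <- s] ++ t); split.
  move=> x; rewrite mem_cat => /orP[/mapP[y ys ->]|]; last exact: Gt.
  exact: (Gs y ys).
rewrite big_cat big_map mulr_sumr; congr (_ + _).
by apply: eq_bigr => x _; rewrite mulrA.
Qed.

Lemma ideal_gen_sub G I : is_ideal I -> G `<=` I -> @ideal_gen A G `<=` I.
Proof.
move=> Iid GI _ [s [Gs ->]]; apply: ideal_sum => // x xs.
by apply: ideal_mull => //; apply/GI/Gs.
Qed.

Lemma colon_ideal I f : is_ideal I -> is_ideal (colon I f).
Proof.
move=> Iid; split=> [|a u v]; rewrite /colon /= ?mul0r; first exact: ideal_zero.
by rewrite mulrDl -mulrA => Iu Iv; apply: ideal_add => //; exact: ideal_mull.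
Qed.

Lemma prime_ideal_prod P (T : eqType) (s : seq T) (F : T -> A) :
  is_prime P -> P (\prod_(x <- s) F x) -> exists2 x, x \in s & P (F x).
Proof.
case/is_primeP=> Pid P1 Ppr; elim: s => [|x s IHs]; first by rewrite big_nil.
rewrite big_cons => /Ppr[PFx|/IHs[y ys PFy]].
  by exists x; rewrite ?mem_head.
by exists y; rewrite // inE ys orbT.
Qed.

Lemma prime_idealX P f k : is_prime P -> P (f ^+ k) -> P f.
Proof.
case/is_primeP=> Pid P1 Ppr; elim: k => [|k IHk]; first by rewrite expr0.
by rewrite exprS => /Ppr[].
Qed.

Lemma frobenius_powerI I q f : I f -> frobenius_power I q (f ^+ q).
Proof. by move=> If; apply: ideal_genI; exists f. Qed.

Lemma frobenius_power_ideal I q : is_ideal (frobenius_power I q).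
Proof. exact: ideal_gen_ideal. Qed.

Lemma frobenius_power_sub I q :
  is_ideal I -> (0 < q)%N -> frobenius_power I q `<=` I.
Proof.
move=> Iid q_gt0; apply: ideal_gen_sub => // _ [a Ia <-].
by rewrite -(prednK q_gt0) exprSr; exact: ideal_mull.
Qed.

Lemma frobenius_power_proper I q :
  is_proper_ideal I -> (0 < q)%N -> is_proper_ideal (frobenius_power I q).
Proof.
case/is_proper_idealP=> Iid I1 q_gt0; apply/is_proper_idealP.
split; first exact: frobenius_power_ideal.
by move/(frobenius_power_sub Iid q_gt0).
Qed.

Section Frobenius.
Variables (q : nat) (pq : [pchar A].-nat q).

(** In characteristic p, f |-> f ^+ q is a ring morphism, so ideals contract
    along it. *)
Lemma frobenius_preimage_ideal J :
  is_ideal J -> is_ideal [set f | J (f ^+ q)].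
Proof.
have q_gt0 : (0 < q)%N by case/andP: pq.
move=> Jid; split=> [|a u v] /=.
  by rewrite expr0n eqn0Ngt q_gt0; exact: ideal_zero.
move=> Ju Jv; rewrite exprDn_pchar //.
by rewrite exprMn_comm; [apply: ideal_add => //; exact: ideal_mull | exact: mulrC].
Qed.

Lemma frobenius_power_comp I r :
  frobenius_power (frobenius_power I r) q = frobenius_power I (r * q).
Proof.
apply/seteqP; split; apply: ideal_gen_sub; try exact: frobenius_power_ideal.
  move=> _ [a Ia <-].
  have /(frobenius_preimage_ideal) Jid := frobenius_power_ideal I (r * q).
  apply: (ideal_gen_sub Jid) Ia => _ [b Ib <-] /=.
  by rewrite -exprM; exact: frobenius_powerI.
move=> _ [a Ia <-]; rewrite exprM.
by apply: frobenius_powerI; exact: frobenius_powerI.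
Qed.

End Frobenius.
End IdealTheory.

(** * Functionals over the subfield of q-th powers *)

Section FieldFunctionals.
Context {K : fieldType}.
Implicit Types (phi : K -> K) (V : set K).

(** Identifying K with K^q by x |-> x ^+ q, these are the K^q-linear maps from
    K to K^q. *)
Definition root_linear (q : nat) phi : Prop :=
  forall a x y, phi (a ^+ q * x + y) = a * phi x + phi y.

Definition power_subspace (q : nat) V : Prop :=
  V 0 /\ forall a x y, V x -> V y -> V (a ^+ q * x + y).

Context {q : nat} (pq : [pchar K].-nat q).

Lemma q_gt0 : (0 < q)%N. Proof. by case/andP: pq. Qed.

Lemma exprqD (x y : K) : (x + y) ^+ q = x ^+ q + y ^+ q.
Proof. exact: exprDn_pchar. Qed.

Lemma exprqB (x y : K) : (x - y) ^+ q = x ^+ q - y ^+ q.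
Proof. by apply/eqP; rewrite eq_sym subr_eq -exprqD subrK. Qed.

Lemma root_linear0 phi : root_linear q phi -> phi 0 = 0.
Proof.
move=> /(_ (-1) 0 0); rewrite mulr0 add0r mulN1r => ->.
by rewrite addNr.
Qed.

(** A maximal subspace W containing V but not c is a hyperplane, and K is the
    direct sum of W and the line spanned by c; the functional is the coordinate
    along c. *)
Lemma root_linear_separate V c : power_subspace q V -> ~ V c ->
  exists phi, [/\ root_linear q phi, forall x, V x -> phi x = 0 & phi c = 1].
Proof.
move=> Vsub Vc.
(* Zorn is applied to sets X through V `|` X, so that the empty chain has an
   upper bound. *)
pose good X := power_subspace q (V `|` X) /\ ~ (V `|` X) c.
have [F Fgood Ftot|X [[[W0 Wcl] Wc] Xmax]] := @Zorn_bigcup K good.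
  have step x y : (V `|` \bigcup_(X in F) X) x ->
      (V `|` \bigcup_(X in F) X) y ->
    V x /\ V y \/ exists2 X, F X & (V `|` X) x /\ (V `|` X) y.
    case=> [Vx|[X FX Xx]] [Vy|[Y FY Yy]].
    - by left.
    - by right; exists Y => //; split; [left|right].
    - by right; exists X => //; split; [right|left].
    - right; have [XY|YX] := Ftot _ _ FX FY.
        by exists Y => //; split; right => //; exact: XY.
      by exists X => //; split; right => //; exact: YX.
  split.
    split; first by left; case: Vsub.
    move=> a x y Ux Uy.
    have [[Vx Vy]|[X FX [Xx Xy]]] := step _ _ Ux Uy.
      by left; case: Vsub => _; apply.
    have [[_ /(_ a x y Xx Xy) XD] _] := Fgood _ FX.
    by case: XD; [left | right; exists X].
  case=> // -[X FX Xc]; have [_] := Fgood _ FX.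
  by apply; right.
pose W := V `|` X.
have WB x y : W x -> W y -> W (x - y).
  move=> Wx Wy; have := Wcl (-1) y x Wy Wx.
  rewrite addrC; suff -> : (-1 : K) ^+ q = -1 by rewrite mulN1r.
  apply/eqP; rewrite -addr_eq0 -[X in _ + X](expr1n _ q) -exprqD addNr.
  by rewrite expr0n eqn0Ngt q_gt0.
have Wscale a x : W x -> W (a ^+ q * x).
  by move=> Wx; have := Wcl a x 0 Wx W0; rewrite addr0.
(* If x were not in W + K^q c, then W + K^q x would be larger than W, so it
   would contain c, which puts x into W + K^q c. *)
have decomp x : exists a, W (x - a ^+ q * c).
  apply: contrapT => xW.
  pose Y := [set y | exists a, W (y - a ^+ q * x)].
  have WY : W `<=` Y.
    move=> y Wy; exists 0.
    by rewrite expr0n eqn0Ngt q_gt0 mul0r subr0.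
  have Yx : Y x by exists 1; rewrite expr1n mul1r subrr.
  have VY : V `|` Y = Y.
    by apply/seteqP; split=> [y [Vy|//]|y Yy]; [apply: WY; left | right].
  apply: (Xmax Y).
    split=> [y Xy|YX]; first by apply: WY; right.
    apply: xW; exists 0; rewrite expr0n eqn0Ngt q_gt0 mul0r subr0.
    by right; exact: YX.
  split; rewrite VY.
    split; first exact: WY.
    move=> a y z [b Wy] [d Wz]; exists (a * b + d).
    rewrite exprqD exprMn_comm; last exact: mulrC.
    rewrite mulrDl opprD addrACA -mulrA -mulrBr.
    exact: Wcl.
  case=> b Wcb; apply: xW; exists b^-1.
  have b0 : b != 0.
    apply/eqP=> b0; apply: Wc; move: Wcb.
    by rewrite b0 expr0n eqn0Ngt q_gt0 mul0r subr0.
  have /(Wscale b^-1) := WB _ _ W0 Wcb.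
  rewrite sub0r opprB mulrBr mulrA -exprMn_comm; last exact: mulrC.
  by rewrite mulVf // expr1n mul1r.
have uniq a b x : W (x - a ^+ q * c) -> W (x - b ^+ q * c) -> a = b.
  move=> Wa Wb; apply/eqP; rewrite -subr_eq0; apply: contraT => ab0.
  case: Wc; have := WB _ _ Wb Wa.
  rewrite opprB addrC addrA subrK -mulrBl -exprqB => /(Wscale (a - b)^-1).
  rewrite mulrA -exprMn_comm; last exact: mulrC.
  by rewrite mulVf // expr1n mul1r.
have [phi phiP] := choice decomp.
exists phi; split.
- move=> a x y; apply: (uniq _ _ (a ^+ q * x + y)); first exact: phiP.
  rewrite exprqD exprMn_comm; last exact: mulrC.
  rewrite mulrDl opprD addrACA -mulrA -mulrBr.
  by apply: Wcl; exact: phiP.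
- move=> x Vx; apply: (uniq _ _ x); first exact: phiP.
  by rewrite expr0n eqn0Ngt q_gt0 mul0r subr0; left.
- by apply: (uniq _ _ c); [exact: phiP | rewrite expr1n mul1r subrr].
Qed.

(** On a given finite set of scalars the b_i play the part of a basis of K over
    K^q, and the phi_i that of its dual basis. A new scalar c costs one more
    functional, which takes the value 1 at c and vanishes on all scalars
    expanded so far; its vector is the defect of the old expansion at c, and no
    linear independence has to be recorded. *)
Lemma root_linear_expand (s : seq K) :
  exists k (phi : nat -> K -> K) (b : nat -> K),
    (forall i, root_linear q (phi i)) /\
    forall x, x \in s -> x = \sum_(i < k) phi i x ^+ q * b i.
Proof.
elim: s => [|c s [k [phi [b [phiL phiE]]]]].
  exists 0%N, (fun _ _ => 0), (fun=> 0); split=> // i a x y.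
  by rewrite mulr0 addr0.
pose V := [set x | x = \sum_(i < k) phi i x ^+ q * b i].
have Vsub : power_subspace q V.
  split=> [|a x y Vx Vy]; rewrite /V /=.
    rewrite big1 // => i _.
    by rewrite root_linear0 // expr0n eqn0Ngt q_gt0 mul0r.
  rewrite {1}Vx {1}Vy mulr_sumr -big_split; apply: eq_bigr => i _ /=.
  by rewrite phiL exprqD exprMn_comm ?mulrDl ?mulrA //; exact: mulrC.
have [Vc|Vc] := pselect (V c).
  exists k, phi, b; split=> // x; rewrite inE => /orP[/eqP->|]; first exact: Vc.
  exact: phiE.
have [psi [psiL psiV psic]] := root_linear_separate Vsub Vc.
pose r := c - \sum_(i < k) phi i c ^+ q * b i.
exists k.+1, (fun i => if i == k then psi else phi i),
  (fun i => if i == k then r else b i).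
split=> [i|x xs]; first by case: ifP.
rewrite big_ord_recr /= eqxx.
rewrite [X in _ = X + _](_ : _ = \sum_(i < k) phi i x ^+ q * b i); last first.
  by apply: eq_bigr => i _; rewrite ltn_eqF.
have [->|xc] := eqVneq x c; first by rewrite psic expr1n mul1r addrC subrK.
have {}xs : V x by apply: phiE; move: xs; rewrite inE (negbTE xc).
by rewrite (psiV _ xs) expr0n eqn0Ngt q_gt0 mul0r addr0.
Qed.

End FieldFunctionals.

(** * Cartier maps *)

Section Cartier.
Context {n : nat} {K : fieldType}.
Implicit Types (phi : K -> K) (m u v w : 'X_{1..n}) (f g h : {mpoly K[n]}).
Implicit Types (I P : set {mpoly K[n]}).

Lemma mcoeff_mulX f w v :
  (f * 'X_[w])@_v = if (w <= v)%MM then f@_(v - w) else 0.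
Proof.
case: ifP => [wv|wNv]; first by rewrite -{1}(submK wv) addmC mcoeffMX.
apply: memN_msupp_eq0; apply/negP; rewrite (perm_mem (msuppMX _ _)).
by case/mapP=> x _ vE; rewrite vE lem_addr in wNv.
Qed.

(** The q-th root of a coordinate of f with respect to a basis of the polynomial
    ring over its subring of q-th powers: phi stands for a coordinate of K over
    K^q, and m for one of the basis monomials, whose exponents are < q. The sum
    is over all monomials u that can have a nonzero coefficient, when q > 0
    and phi 0 = 0. *)
Definition cartier (q : nat) phi m f : {mpoly K[n]} :=
  \sum_(u : 'X_{1..n < msize f}) phi f@_(u *+ q + m) *: 'X_[u].

Context {q : nat} (pq : [pchar K].-nat q).

Lemma mcoeff_cartier phi m f u : phi 0 = 0 ->
  (cartier q phi m f)@_u = phi f@_(u *+ q + m).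
Proof.
move=> phi0; have [uf|fu] := ltnP (mdeg u) (msize f).
  by rewrite /cartier (mcoeff_mpoly (fun u => phi f@_(u *+ q + m))).
have -> : f@_(u *+ q + m) = 0.
  apply/memN_msupp_eq0/msize_mdeg_ge/(leq_trans fu).
  by rewrite mdegD mdegMn (leq_trans _ (leq_addr _ _)) // leq_pmulr ?(q_gt0 pq).
rewrite phi0 /cartier raddf_sum big1 // => v _ /=.
rewrite mcoeffZ mcoeffX; case: eqP => [vu|]; last by rewrite mulr0.
by move: fu; rewrite -vu leqNgt bmdeg.
Qed.

Lemma cartierD phi m f g : root_linear q phi ->
  cartier q phi m (f + g) = cartier q phi m f + cartier q phi m g.
Proof.
move=> phiL; have phi0 := root_linear0 phiL; apply/mpolyP=> u.
rewrite mcoeffD !mcoeff_cartier // mcoeffD.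
by have := phiL 1 f@_(u *+ q + m) g@_(u *+ q + m); rewrite expr1n !mul1r.
Qed.

Lemma pchar_mpoly_nat : [pchar {mpoly K[n]}].-nat q.
Proof.
apply: sub_in_pnat pq => x _ /=.
exact: (rmorph_pchar (@mpolyC n K)).
Qed.

Lemma cartierM phi m a f : root_linear q phi -> (forall i, (m i < q)%N) ->
  cartier q phi m (a ^+ q * f) = a * cartier q phi m f.
Proof.
move=> phiL mq; have phi0 := root_linear0 phiL.
elim/mpolyind: a => [|c w a _ _ IHa].
  rewrite expr0n eqn0Ngt (q_gt0 pq) !mul0r; apply/mpolyP=> u.
  by rewrite mcoeff_cartier // !mcoeff0.
rewrite exprDn_pchar ?pchar_mpoly_nat // !mulrDl cartierD // IHa; congr (_ + _).
apply/mpolyP=> u; rewrite mcoeff_cartier //.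
rewrite -!scalerAl exprZn mpolyXn -scalerAl !mcoeffZ.
have phiM x : phi (c ^+ q * x) = c * phi x.
  by have := phiL c x 0; rewrite phi0 !addr0.
rewrite phiM; congr (_ * _).
rewrite ![_ * f]mulrC ![_ * cartier q _ _ _]mulrC !mcoeff_mulX mcoeff_cartier //.
have -> : (w *+ q <= u *+ q + m)%MM = (w <= u)%MM.
  apply/mnm_lepP/mnm_lepP => wu i; have := wu i; rewrite mnmDE !mulmnE; last first.
    by move=> le_wu; rewrite (leq_trans _ (leq_addr _ _)) // leq_mul2r le_wu orbT.
  move=> le_wu; rewrite leqNgt; apply/negP => lt_uw.
  have: (w i * q < (u i).+1 * q)%N.
    by rewrite mulSnr (leq_ltn_trans le_wu) // ltn_add2l.
  by rewrite ltn_mul2r ltnS (leqNgt (w i)) lt_uw andbF.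
case: ifP => // /mnm_lepP wu; congr (phi f@_ _).
apply/mnmP=> i; rewrite mnmDE mnmBE mnmDE !mulmnE mnmBE mulnBl.
by rewrite addnBAC // leq_mul2r wu orbT.
Qed.

Lemma cartier0 phi m : root_linear q phi -> cartier q phi m 0 = 0.
Proof.
move=> phiL; apply/mpolyP=> u.
by rewrite mcoeff_cartier ?mcoeff0 ?(root_linear0 phiL).
Qed.

Lemma cartier_homog phi m f d : root_linear q phi -> f \is d.-homog ->
  cartier q phi m f != 0 ->
  exists2 d', cartier q phi m f \is d'.-homog & d = (q * d' + mdeg m)%N.
Proof.
move=> phiL fd; have phi0 := root_linear0 phiL; set g := cartier q phi m f.
have supp_deg u : u \in msupp g -> d = (q * mdeg u + mdeg m)%N.
  rewrite mcoeff_msupp mcoeff_cartier // => phiu.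
  have: (u *+ q + m)%MM \in msupp f.
    by rewrite mcoeff_msupp; apply: contraNneq phiu => ->; rewrite phi0.
  by move/(dhomog_mf fd) <-; rewrite /= mdegD mdegMn mulnC.
move=> /mlead_supp/supp_deg dE; exists (mdeg (mlead g)) => //.
apply/dhomogP => u /supp_deg; rewrite {1}dE => /eqP.
by rewrite eqn_add2r eqn_pmul2l ?(q_gt0 pq) // => /eqP ->.
Qed.

Lemma cartierZX phi m c w : root_linear q phi -> (forall i, (m i < q)%N) ->
  cartier q phi m (c *: 'X_[w]) =
  if m == [multinom (w i %% q)%N | i < n]
  then phi c *: 'X_[[multinom (w i %/ q)%N | i < n]] else 0.
Proof.
move=> phiL mq; have phi0 := root_linear0 phiL; apply/mpolyP=> u.
rewrite mcoeff_cartier // mcoeffZ mcoeffX (fun_if (mcoeff u)) mcoeff0.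
rewrite mcoeffZ mcoeffX.
have wE : (w == u *+ q + m)%MM = (m == [multinom (w i %% q)%N | i < n]) &&
    ([multinom (w i %/ q)%N | i < n] == u).
  apply/eqP/andP => [->|[/eqP-> /eqP<-]].
    split; apply/eqP/mnmP=> i; rewrite mnmE mnmDE mulmnE.
      by rewrite modnMDl modn_small.
    by rewrite divnMDl ?(q_gt0 pq) // divn_small ?addn0.
  by apply/mnmP=> i; rewrite mnmDE mulmnE !mnmE -divn_eq.
rewrite wE; case: eqP => //= _; last by rewrite mulr0.
by case: eqP; rewrite ?mulr1 ?mulr0.
Qed.

(** Split the exponents of f according to their residues modulo q, and expand
    each coefficient over K^q. *)
Lemma cartier_expand f :
  exists (T : finType) (phi : T -> K -> K) (m : T -> 'X_{1..n})
         (s : T -> {mpoly K[n]}),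
    [/\ forall t, root_linear q (phi t),
        forall t i, (m t i < q)%N
      & f = \sum_t s t * cartier q (phi t) (m t) f ^+ q].
Proof.
have [k [phi [b [phiL phiE]]]] :=
  root_linear_expand pq [seq f@_w | w <- msupp f].
pose T : finType := ('I_k * {ffun 'I_n -> 'I_q})%type.
pose m (r : {ffun 'I_n -> 'I_q}) : 'X_{1..n} := [multinom (r i : nat) | i < n].
have mq r i : (m r i < q)%N by rewrite mnmE.
exists T, (fun t : T => phi t.1), (fun t : T => m t.2),
  (fun t : T => b t.1 *: 'X_[m t.2]).
split=> [//|t i|]; first exact: mq.
pose G g := \sum_(t : T) b t.1 *: 'X_[m t.2] * cartier q (phi t.1) (m t.2) g ^+ q.
have GD g h : G (g + h) = G g + G h.
  rewrite /G -big_split; apply: eq_bigr => t _ /=.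
  by rewrite cartierD // exprDn_pchar ?pchar_mpoly_nat // mulrDr.
have G0 : G 0 = 0.
  rewrite /G big1 // => t _.
  by rewrite cartier0 // expr0n eqn0Ngt (q_gt0 pq) mulr0.
rewrite -/(G f) {2}[f]mpolyE (big_morph G GD G0) {1}[f]mpolyE.
rewrite big_seq [RHS]big_seq; apply: eq_bigr => w wf.
have cE := phiE _ (map_f (fun w => f@_w) wf).
pose r0 : {ffun 'I_n -> 'I_q} := [ffun i => Ordinal (ltn_pmod (w i) (q_gt0 pq))].
have mr0 : m r0 = [multinom (w i %% q)%N | i < n].
  by apply/mnmP=> i; rewrite !mnmE ffunE.
rewrite /G -(pair_bigA _ (fun (i : 'I_k) (r : {ffun 'I_n -> 'I_q}) =>
  b i *: 'X_[m r] * cartier q (phi i) (m r) (f@_w *: 'X_[w]) ^+ q)) /=.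
rewrite {1}cE scaler_suml; apply: eq_bigr => i _.
rewrite (bigD1 r0) //= [X in _ + X]big1 => [|r rr0]; last first.
  rewrite cartierZX // -mr0 ifN ?expr0n ?eqn0Ngt ?(q_gt0 pq) ?mulr0 //.
  apply: contraNneq rr0 => mE; apply/eqP/ffunP=> j; apply/val_inj => /=.
  by have /mnmP/(_ j) := mE; rewrite !mnmE.
rewrite addr0 cartierZX // -mr0 eqxx exprZn mpolyXn.
rewrite -scalerAl -scalerAr scalerA -mpolyXD mulrC; congr (_ *: 'X_[_]).
by apply/mnmP=> j; rewrite mnmDE mulmnE !mnmE ffunE /= addnC -divn_eq.
Qed.

(** * Frobenius powers through Cartier maps *)

(** With the next lemma, this is how the flatness of the Frobenius endomorphism
    is used: membership in I^[q] is membership in I of all Cartier images. *)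
Lemma frobenius_power_cartier I f phi m : is_ideal I ->
  root_linear q phi -> (forall i, (m i < q)%N) ->
  frobenius_power I q f -> I (cartier q phi m f).
Proof.
move=> Iid phiL mq If; pose J := [set g | forall h, I (cartier q phi m (h * g))].
suff: J f by move/(_ 1); rewrite mul1r.
apply: ideal_gen_sub If => [|_ [a Ia <-] h].
  split=> [h|a u v Ju Jv h]; first by rewrite mulr0 cartier0 //; apply: ideal_zero.
  rewrite mulrDr mulrA cartierD //; exact: ideal_add.
by rewrite mulrC cartierM //; exact: ideal_mulr.
Qed.

Lemma cartier_frobenius_power I f :
  (forall phi m, root_linear q phi -> (forall i, (m i < q)%N) ->
    I (cartier q phi m f)) ->
  frobenius_power I q f.
Proof.
move=> If; have [T [phi [m [s [phiL mq ->]]]]] := cartier_expand f.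
have Iid := frobenius_power_ideal I q.
apply: ideal_sum => // t _; apply: ideal_mull => //.
by apply: frobenius_powerI; exact: If.
Qed.

Lemma colon_frobenius_power I f : is_ideal I ->
  colon (frobenius_power I q) (f ^+ q) = frobenius_power (colon I f) q.
Proof.
move=> Iid; apply/seteqP; split.
  move=> g Igf; apply: cartier_frobenius_power => phi m phiL mq.
  rewrite /colon /= mulrC -cartierM // mulrC.
  exact: frobenius_power_cartier.
apply: ideal_gen_sub => [|_ [a Ia <-]].
  exact/colon_ideal/frobenius_power_ideal.
rewrite /colon /= -exprMn_comm; last exact: mulrC.
exact: frobenius_powerI.
Qed.

(** An element f outside P is regular modulo P, so f ^+ q is regular modulo
    P^[q]; hence f is. *)
Lemma prime_frobenius_power_regular P f g : is_prime P ->
  ~ P f -> frobenius_power P q (f * g) -> frobenius_power P q g.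
Proof.
move=> Ppr Pf Pfg; have Pid := prime_ideal Ppr.
apply: cartier_frobenius_power => phi m phiL mq.
have: P (cartier q phi m (f ^+ q * g)).
  apply: frobenius_power_cartier => //.
  rewrite [f ^+ q](_ : _ = f ^+ q.-1 * f); last first.
    by rewrite -exprSr (prednK (q_gt0 pq)).
  rewrite -mulrA.
  by apply: ideal_mull => //; exact: frobenius_power_ideal.
by rewrite cartierM //; case/is_primeP: Ppr => _ _ Ppr /Ppr[].
Qed.

(** The colon ideal by f is, up to radical, the intersection of the finitely
    many colon ideals by the Cartier images of f, and a prime containing a
    finite intersection contains one of its members. *)
Lemma colon_frobenius_power_prime I f P : is_ideal I -> is_prime P ->
  colon (frobenius_power I q) f = P ->
  exists phi m, [/\ root_linear q phi, forall i, (m i < q)%N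
    & colon I (cartier q phi m f) = P].
Proof.
move=> Iid Ppr IfP; have [T [phi [m [s [phiL mq fE]]]]] := cartier_expand f.
have sub t : P `<=` colon I (cartier q (phi t) (m t) f).
  move=> a; rewrite -IfP /colon /= => Iaf; rewrite -cartierM //.
  apply: frobenius_power_cartier => //.
  rewrite [a ^+ q](_ : _ = a ^+ q.-1 * a); last first.
    by rewrite -exprSr (prednK (q_gt0 pq)).
  rewrite -mulrA.
  by apply: ideal_mull => //; exact: frobenius_power_ideal.
apply: contrapT => noP.
have {}noP t : exists a, colon I (cartier q (phi t) (m t) f) a /\ ~ P a.
  apply: contrapT => Na; apply: noP; exists (phi t), (m t); split=> //.
  apply/seteqP; split=> [a Ia|]; last exact: sub.
  by apply: contrapT => Pa; apply: Na; exists a.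
have [a aP] := choice noP.
have: P (\prod_(t <- enum T) a t).
  apply: (prime_idealX (k := q)) => //; rewrite -IfP /colon /= {1}fE mulr_sumr.
  have Jid := frobenius_power_ideal I q.
  apply: ideal_sum => // t _; rewrite mulrCA; apply: ideal_mull => //.
  rewrite -exprMn_comm; last exact: mulrC.
  apply: frobenius_powerI; rewrite (big_rem t) ?mem_enum //= mulrC mulrA.
  by rewrite mulrC; apply: ideal_mull => //; rewrite mulrC; case: (aP t).
case/(prime_ideal_prod Ppr) => t _.
by case: (aP t).
Qed.

Lemma mcoeff_pihomog d f u :
  (pihomog mdeg d f)@_u = if mdeg u == d then f@_u else 0.
Proof.
rewrite pihomogE big_mkcond raddf_sum /=.
transitivity (\sum_(v <- msupp f)
    (if v == u then if mdeg u == d then f@_u else 0 else 0)); last first.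
  rewrite -big_mkcond /=; case: ifP => [_|_]; last by rewrite big1.
  have [uf|uf] := boolP (u \in msupp f).
    rewrite (big_rem u) //= eqxx big1_seq ?addr0 // => v /andP[/eqP->].
    by rewrite mem_rem_uniq ?inE ?eqxx.
  rewrite (memN_msupp_eq0 uf) big1 //.
apply: eq_bigr => v _; case: ifP => vd; rewrite ?mcoeffZ ?mcoeffX ?mcoeff0.
  by case: eqP => [<-|_]; rewrite ?mulr0 // vd mulr1.
by case: eqP => // <-; rewrite vd.
Qed.

(** Cartier maps take homogeneous components to homogeneous components, so
    membership can again be tested on Cartier images. *)
Lemma frobenius_power_graded I : is_ideal I -> is_graded I ->
  is_graded (frobenius_power I q).
Proof.
move=> Iid Igr f d If; apply: cartier_frobenius_power => phi m phiL mq.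
have phi0 := root_linear0 phiL.
have := frobenius_power_cartier Iid phiL mq If.
have [dm|dm] := boolP ((mdeg m <= d) && (q %| d - mdeg m))%N; last first.
  suff -> : cartier q phi m (pihomog mdeg d f) = 0 by move=> _; apply: ideal_zero.
  apply/mpolyP=> u; rewrite mcoeff_cartier // mcoeff_pihomog mcoeff0.
  case: eqP => // dE; case/negP: dm; rewrite -dE mdegD mdegMn leq_addl addnK.
  exact: dvdn_mull.
move/(Igr _ ((d - mdeg m) %/ q)%N); congr (I _); apply/mpolyP=> u.
rewrite mcoeff_pihomog !mcoeff_cartier // mcoeff_pihomog mdegD mdegMn.
have -> : (mdeg u * q + mdeg m == d)%N = (mdeg u == (d - mdeg m) %/ q)%N.
  case/andP: dm => md qd; rewrite -{1}(subnK md) eqn_add2r -{1}(divnK qd).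
  by rewrite eqn_pmul2r ?(q_gt0 pq).
by case: ifP.
Qed.

End Cartier.

(** * Ascending chains of ideals *)

Section Noetherian.

(** Always pass to the next index at which the minimum of the remaining tail is
    attained. *)
Lemma monotone_subsequence (u : nat -> nat) :
  exists s : nat -> nat, (forall k, s k < s k.+1)%N /\
    forall k, (u (s k) <= u (s k.+1))%N.
Proof.
have tail_min N : exists i, (N <= i)%N /\ forall j, (N <= j -> u i <= u j)%N.
  have exv : exists v, `[< exists2 i, (N <= i)%N & u i = v >].
    by exists (u N); apply/asboolP; exists N.
  case: (ex_minnP exv) => v /asboolP[i Ni uiv] vmin; exists i; split=> // j Nj.
  by rewrite uiv; apply: vmin; apply/asboolP; exists j.
have [g gP] := choice tail_min.
pose s k := iter k (fun i => g i.+1) (g 0%N).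
have s_incr k : (s k < s k.+1)%N by case: (gP (s k).+1).
exists s; split=> // k.
have [N sN] : exists N, s k = g N by case: k => [|k]; [exists 0%N | exists (s k).+1].
have [leN gmin] := gP N; rewrite {1}sN; apply: gmin.
by rewrite (leq_trans leN) // -sN ltnW.
Qed.

(** Extracting subsequences that are monotone in one more coordinate each time
    makes all coordinates monotone. *)
Lemma dickson n (u : nat -> 'X_{1..n}) :
  exists i j, (i < j)%N /\ (u i <= u j)%MM.
Proof.
have sub k : (k <= n)%N -> exists s : nat -> nat, (forall i, s i < s i.+1)%N /\
    forall i (c : 'I_n), (c < k)%N -> (u (s i) c <= u (s i.+1) c)%N.
  elim: k => [_|k IHk lt_kn]; first by exists id; split.
  have [s [s_incr s_mono]] := IHk (ltnW lt_kn).
  have [t [t_incr t_mono]] :=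
    monotone_subsequence (fun i => u (s i) (Ordinal lt_kn)).
  exists (s \o t); split=> [i|i c] /=.
    exact: (homo_ltn ltn_trans s_incr).
  rewrite ltnS leq_eqVlt => /orP[/eqP ck|ck].
    by have := t_mono i; congr (u _ _ <= u _ _)%N; apply: val_inj.
  apply: (homo_leq leqnn leq_trans (f := fun i => u (s i) c)); last exact: ltnW.
  by move=> j; apply: s_mono.
have [s [s_incr s_mono]] := sub n (leqnn n).
exists (s 0%N), (s 1%N); split; first exact: s_incr.
by apply/mnm_lepP => c; apply: s_mono.
Qed.

Context {n : nat} {K : fieldType}.
Implicit Types (f g h : {mpoly K[n]}) (I J P : set {mpoly K[n]}).

Lemma exists_min_mlead (G : set {mpoly K[n]}) g : G g ->
  exists2 h, G h & forall h', G h' -> ~ (mlead h' < mlead h)%O.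
Proof.
have [w] : exists w, w = mlead g by exists (mlead g).
elim/(well_founded_ind (@ltom_wf n)): w g => w IHw g wE Gg.
have [[h [Gh hg]]|noh] := pselect (exists h, G h /\ (mlead h < mlead g)%O).
  by apply: (IHw (mlead h)) Gh; rewrite ?wE.
by exists g => // h Gh hg; apply: noh; exists h.
Qed.

(** If h_k in J_(k+1) \ J_k has least possible leading monomial, then no earlier
    leading monomial divides that of h_k: otherwise the leading term could be
    cancelled. *)
Lemma mpoly_noetherian (J : nat -> set {mpoly K[n]}) :
  (forall k, is_ideal (J k)) -> (forall k, J k `<=` J k.+1) ->
  exists k, J k.+1 `<=` J k.
Proof.
move=> Jid Jincr; apply: contrapT => Jstrict.
have hex k : exists h, (J k.+1 h /\ ~ J k h) /\
    forall h', J k.+1 h' /\ ~ J k h' -> ~ (mlead h' < mlead h)%O.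
  have [g Gg] : exists g, J k.+1 g /\ ~ J k g.
    apply: contrapT => Ng; apply: Jstrict; exists k => g Jg.
    by apply: contrapT => Jkg; apply: Ng; exists g.
  by have [h Gh hmin] := exists_min_mlead (G := fun g => J k.+1 g /\ ~ J k g) Gg;
    exists h.
have [h hP] := choice hex.
have Jmono i j : (i <= j)%N -> J i `<=` J j.
  move/subnK <-; elim: (j - i)%N => [//|d IHd]; rewrite addSn.
  by apply: subset_trans IHd _; exact: Jincr.
have h0 k : h k != 0.
  apply/eqP=> hk0; case: (hP k) => -[_ +] _; apply.
  by rewrite hk0; apply: ideal_zero.
have [i [j [lt_ij le_hij]]] := dickson (fun k => mlead (h k)).
pose w := (mlead (h j) - mlead (h i))%MM.
pose c := mleadc (h j) / mleadc (h i).
have hi0 : mleadc (h i) != 0 by rewrite mleadc_eq0.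
have hj0 : mleadc (h j) != 0 by rewrite mleadc_eq0.
have c0 : c != 0 by rewrite mulf_neq0 ?invr_eq0.
pose t := c *: (h i * 'X_[w]).
have Jt : J j t.
  rewrite /t -mul_mpolyC; apply: ideal_mull => //; rewrite mulrC.
  apply: ideal_mull => //; apply: (Jmono i.+1) => //.
  by case: (hP i) => -[].
have tlead : mlead t = mlead (h j).
  rewrite mleadZ // mleadM // ?mleadXm; last first.
    by rewrite -msupp_eq0 msuppX.
  by rewrite addmC submK.
have [[Jh NJh] hmin] := hP j.
have NJd : ~ J j (h j - t).
  by move=> Jd; apply: NJh; rewrite -[h j](subrK t); apply: ideal_add.
have d0 : h j - t != 0.
  by apply/eqP=> d0; apply: NJd; rewrite d0; apply: ideal_zero.
apply: (hmin (h j - t)).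
  split=> //; apply: ideal_sub => //; exact: Jincr.
rewrite lt_neqAle; apply/andP; split; last first.
  by have := mleadB_le (h j) t; rewrite tlead joinxx.
apply: contraNneq d0 => dlead; rewrite -mleadc_eq0 dlead mcoeffB mcoeffZ.
rewrite -[X in (_ * 'X_[w])@_X](submK le_hij) mcoeffMX.
by rewrite divfK // subrr.
Qed.

Lemma exists_maximal_ideal (F : set (set {mpoly K[n]})) J0 :
  (forall J, F J -> is_ideal J) -> F J0 ->
  exists2 J, F J & forall J', F J' -> J `<=` J' -> J' `<=` J.
Proof.
move=> Fid FJ0; apply: contrapT => Nmax.
have step J : exists J', F J -> [/\ F J', J `<=` J' & ~ J' `<=` J].
  have [FJ|] := pselect (F J); last by exists J.
  apply: contrapT => NJ'; apply: Nmax; exists J => // J' FJ' JJ'.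
  by apply: contrapT => J'J; apply: NJ'; exists J'.
have [s sP] := choice step.
have Fs k : F (iter k s J0) by elim: k => //= k /sP[].
have [k] := mpoly_noetherian (fun k => Fid _ (Fs k))
  (fun k => let: And3 _ sub _ := sP _ (Fs k) in sub).
by rewrite /=; case: (sP _ (Fs k)).
Qed.

(** * Graded ideals and the existence of homogeneous prime colon ideals *)

Lemma pihomogMhomog d d' f g : f \is d.-homog ->
  pihomog mdeg d' (g * f) =
  if (d <= d')%N then pihomog mdeg (d' - d) g * f else 0.
Proof.
move=> fd; elim/mpolyind: g => [|c w g _ _ IHg].
  by rewrite mul0r !raddf0 mul0r if_same.
rewrite mulrDl !raddfD /= IHg mulrDl.
suff -> : pihomog mdeg d' (c *: 'X_[w] * f) =
    if (d <= d')%N then pihomog mdeg (d' - d) (c *: 'X_[w]) * f else 0.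
  by case: ifP; rewrite ?addr0.
rewrite -scalerAl !linearZ /= pihomogX -scalerAl.
have wf : 'X_[w] * f \is (mdeg w + d).-homog.
  by apply: dhomogM => //; rewrite dhomogX.
have [dE|dN] := eqVneq (mdeg w + d)%N d'.
  rewrite -dE addnK eqxx leq_addl pihomog_dE // dE.
rewrite (pihomog_ne0 dN wf) scaler0; case: ifP => // le_dd'.
by rewrite -(eqn_add2r d) subnK // (negbTE dN) mul0r scaler0.
Qed.

Lemma colon_graded I f d : is_graded I -> f \is d.-homog ->
  is_graded (colon I f).
Proof.
move=> Igr fd g e; rewrite /colon /= => /(Igr _ (e + d)%N).
by rewrite (pihomogMhomog _ _ fd) leq_addl addnK.
Qed.

(** Of two elements outside the ideal, compare the homogeneous components of
    largest degree lying outside it. *)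
Lemma graded_prime P : is_ideal P -> ~ P 1 -> is_graded P ->
  (forall f g d e, f \is d.-homog -> g \is e.-homog -> P (f * g) -> P f \/ P g) ->
  is_prime P.
Proof.
move=> Pid P1 Pgr Phom; apply/is_primeP; split=> // u v Puv.
have top f : ~ P f -> exists i, ~ P (pihomog mdeg i f) /\
    forall j, (i < j)%N -> P (pihomog mdeg j f).
  move=> Pf.
  have bound i : `[< ~ P (pihomog mdeg i f) >] -> (i <= msize f)%N.
    move/asboolP => Pfi; rewrite leqNgt; apply/negP => lt_fi; apply: Pfi.
    rewrite pihomogE big_seq_cond big_pred0; first exact: ideal_zero.
    move=> m; apply/negbTE/negP => /andP[mf /eqP dm].
    by have := msize_mdeg_lt mf; rewrite -/(mdeg m) dm ltnNge ltnW.
  have exi : exists i, `[< ~ P (pihomog mdeg i f) >].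
    apply: contrapT => Ni; apply: Pf.
    rewrite (pihomog_partitionE (mf := mdeg) (leqnn (msize f))).
    apply: ideal_sum => // i _; apply: contrapT => Pi; apply: Ni.
    by exists i; apply/asboolP.
  case: (ex_maxnP exi bound) => i /asboolP Pi imax; exists i; split=> // j lt_ij.
  apply: contrapT => Pj; have /imax : `[< ~ P (pihomog mdeg j f) >] by apply/asboolP.
  by rewrite leqNgt lt_ij.
apply: contrapT => /not_orP[Pu Pv].
have [i [Pui imax]] := top _ Pu; have [j [Pvj jmax]] := top _ Pv.
suff /Phom : P (pihomog mdeg i u * pihomog mdeg j v).
  by case/(_ i j); [exact: pihomogP | exact: pihomogP | |].
have := Pgr _ (i + j)%N Puv.
pose k := maxn i.+1 (msize u).
rewrite {1}(pihomog_partitionE (mf := mdeg) (leq_maxr i.+1 (msize u))) -/k.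
have lt_ik : (i < k)%N by rewrite leq_max leqnn.
rewrite mulr_suml raddf_sum /= (bigD1 (Ordinal lt_ik)) //=.
have term l : pihomog mdeg (i + j) (pihomog mdeg l u * v) =
    if (l <= i + j)%N then pihomog mdeg l u * pihomog mdeg (i + j - l) v else 0.
  rewrite mulrC (pihomogMhomog _ _ (pihomogP _ l u)).
  by case: ifP => // _; rewrite mulrC.
rewrite term leq_addr addKn => Psum.
rewrite -[X in P X](addrK (\sum_(l < k | l != Ordinal lt_ik)
  pihomog mdeg (i + j) (pihomog mdeg l u * v))).
apply: ideal_sub => //; rewrite big_mkcond; apply: ideal_sum => // l _.
case: ifP => [li|_]; last exact: ideal_zero.
rewrite term; case: ifP => [lij|_]; last exact: ideal_zero.
have [lt_li|lt_il|le_li] := ltngtP l i.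
- apply: ideal_mull => //; apply: jmax.
  by rewrite ltn_subRL ltn_add2r.
- by rewrite mulrC; apply: ideal_mull => //; apply: imax.
- by case/eqP: li; apply: val_inj.
Qed.

(** A colon ideal by a homogeneous element that is maximal among the proper
    ones is prime. *)
Lemma exists_homog_prime_colon I : is_proper_ideal I -> is_graded I ->
  exists f d, f \is d.-homog /\ is_prime (colon I f).
Proof.
move=> /is_proper_idealP[Iid I1] Igr.
pose F := [set J | exists f d, [/\ f \is d.-homog, ~ I f & colon I f = J]].
have [||J [f [d [fd If <-]]] Jmax] := @exists_maximal_ideal F I.
- by move=> _ [f [d [_ _ <-]]]; apply: colon_ideal.
- exists 1, 0%N; split=> //; first exact: dhomog1.
  by apply/seteqP; split=> g; rewrite /colon /= mulr1.
exists f, d; split=> //; apply: graded_prime.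
- exact: colon_ideal.
- by rewrite /colon /= mul1r.
- exact: colon_graded fd.
move=> a b da db ah bh; rewrite /colon /= => Iabf.
have [Iaf|Iaf] := pselect (I (a * f)); [by left | right].
apply: (Jmax (colon I (a * f))).
- by exists (a * f), (da + d)%N; split=> //; apply: dhomogM.
- by move=> g; rewrite /colon /= mulrCA => ?; apply: ideal_mull.
- by rewrite /colon /= mulrA [b * a]mulrC.
Qed.

(** * The minimum defining the v-number *)

Lemma nat_minP (A : set nat) k : A k ->
  A (nat_min A) /\ forall j, A j -> (nat_min A <= j)%N.
Proof.
move=> Ak; have exA : exists k, `[< A k >] by exists k; apply/asboolP.
case: (ex_minnP exA) => m /asboolP Am mmin.
rewrite /nat_min; case: xgetP => [x _ [Ax xlb]|/(_ m) []].
  by split=> // j Aj; have := xlb _ Aj; rewrite leEnat.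
by split=> // j Aj; rewrite leEnat; apply/mmin/asboolP.
Qed.

Lemma v_number_attained I : is_proper_ideal I -> is_graded I ->
  exists f, f \is (v_number I).-homog /\ is_prime (colon I f).
Proof.
move=> Ipr Igr; have [f [d [fd fpr]]] := exists_homog_prime_colon Ipr Igr.
have : [set d | exists (f : {mpoly K[n]}) (P : set {mpoly K[n]}),
    [/\ f \is d.-homog, Ass I P & colon I f = P]] d.
  by exists f, (colon I f); split=> //; split=> //; exists f.
case/nat_minP => -[g [P [gd [Ppr _] gP]]] _.
by exists g; rewrite gP.
Qed.

Lemma v_number_le I f d : f \is d.-homog -> is_prime (colon I f) ->
  (v_number I <= d)%N.
Proof.
move=> fd fpr; have : [set d | exists (f : {mpoly K[n]}) (P : set {mpoly K[n]}),
    [/\ f \is d.-homog, Ass I P & colon I f = P]] d.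
  by exists f, (colon I f); split=> //; split=> //; exists f.
case/nat_minP => _ /(_ d); apply.
by exists f, (colon I f); split=> //; split=> //; exists f.
Qed.

End Noetherian.

(** * Chains of primes in a polynomial ring *)

Section Dimension.
Context {n : nat} {K : fieldType}.
Implicit Types (f g : {mpoly K[n]}) (a : seq {mpoly K[n]}).
Implicit Types (c : seq nat -> K) (m : seq nat).

(** Exponent vectors are lists here, so that sums over a box unfold one element
    at a time. *)
Fixpoint boxes (D r : nat) : seq (seq nat) :=
  if r is r'.+1 then [seq k :: m | k <- iota 0 D, m <- boxes D r'] else [:: [::]].

Fixpoint seq_monomial a m : {mpoly K[n]} :=
  match a, m with
  | x :: a', k :: m' => x ^+ k * seq_monomial a' m'
  | _, _ => 1
  end.

Definition box_sum D c a : {mpoly K[n]} :=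
  \sum_(m <- boxes D (size a)) c m *: seq_monomial a m.

Lemma box_sum_cons D c x a :
  box_sum D c (x :: a) =
  \sum_(k < D) x ^+ k * box_sum D (fun m => c ((k : nat) :: m)) a.
Proof.
rewrite /box_sum /= big_allpairs_dep /= -(big_mkord xpredT (fun k : nat =>
  x ^+ k * \sum_(m <- boxes D (size a)) c (k :: m) *: seq_monomial a m)).
rewrite /index_iota subn0; apply: eq_bigr => k _; rewrite mulr_sumr.
by apply: eq_bigr => m _; rewrite scalerAr.
Qed.

Lemma size_boxes D r : size (boxes D r) = (D ^ r)%N.
Proof. by elim: r => //= r IHr; rewrite size_allpairs size_iota IHr expnS. Qed.

Lemma boxes_uniq D r : uniq (boxes D r).
Proof.
elim: r => //= r IHr; apply: allpairs_uniq => //; first exact: iota_uniq.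
by move=> [k m] [k' m'] _ _ /= [-> ->].
Qed.

(** Coquand and Lombardi's elementary treatment of Krull dimension: if the
    relation lies in C_0, divide it by the least power of the first element
    that occurs, which lies outside C_0; the part of the quotient free of that
    element then lies in C_1. *)
Lemma prime_chain_independent D a c (C : nat -> set {mpoly K[n]}) :
  (forall i, (i <= size a)%N -> is_prime (C i)) ->
  (forall i, (i < size a)%N ->
    [/\ C i `<=` C i.+1, C i.+1 a`_i & ~ C i a`_i]) ->
  C 0%N (box_sum D c a) -> forall m, m \in boxes D (size a) -> c m = 0.
Proof.
elim: a c C => [|x a IHa] c C Cpr Cstep.
  rewrite /box_sum big_seq1 => C0 m; rewrite inE => /eqP->.
  apply/eqP/contraT => c0; have /is_primeP[Cid C1 _] := Cpr 0%N isT; case: C1.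
  by rewrite -[1](scalerK c0) -mul_mpolyC; apply: ideal_mull.
rewrite box_sum_cons => C0.
pose E k := box_sum D (fun m => c (k :: m)) a.
have {}IHa k : C 1%N (E k) -> forall m, m \in boxes D (size a) -> c (k :: m) = 0.
  by apply: (IHa (fun m => c (k :: m)) (fun i => C i.+1)) => i ia;
    [exact: Cpr | exact: (Cstep i.+1)].
have [C01 C1x C0x] := Cstep 0%N isT.
have /is_primeP[C0id _ C0pr] := Cpr 0%N isT.
have /is_primeP[C1id _ _] := Cpr 1%N isT.
suff cz k : (k < D)%N -> forall m, m \in boxes D (size a) -> c (k :: m) = 0.
  move=> m /= /allpairsP[[k m'] /= [kD m'a ->]]; apply: cz => //.
  by move: kD; rewrite mem_iota.
have [N] := ubnP k; elim: N k => // N IHN k; rewrite ltnS => le_kN lt_kD.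
apply: IHa.
have Ej j : (j < k)%N -> E j = 0.
  move=> lt_jk; rewrite /E /box_sum big_seq big1 // => m ma.
  by rewrite IHN ?scale0r //; [exact: leq_trans lt_jk _ | exact: ltn_trans lt_kD].
pose B := \sum_(j < D | j != Ordinal lt_kD)
  (if (k < j)%N then x ^+ (j - k.+1) * E j else 0).
have sumE : \sum_(j < D) x ^+ j * E j = x ^+ k * (E k + x * B).
  rewrite (bigD1 (Ordinal lt_kD)) //= mulrDr; congr (_ + _).
  rewrite mulrA -exprSr /B mulr_sumr; apply: eq_bigr => j jk.
  case: ltngtP => [lt_kj|lt_jk|kj].
  - by rewrite mulrA -exprD subnKC.
  - by rewrite Ej // !mulr0.
  - by case/eqP: jk; apply: val_inj.
move: C0; rewrite -/E sumE => /C0pr[/(prime_idealX (Cpr 0%N isT))//|/C01 C1E].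
rewrite -[E k](addrK (x * B)); apply: ideal_sub => //.
by rewrite mulrC; apply: ideal_mull.
Qed.

Lemma msizeM_bound f g d e : (msize f <= d.+1)%N ->
  (msize g <= e.+1)%N -> (msize (f * g) <= (d + e).+1)%N.
Proof.
move=> fd ge; have [->|f0] := eqVneq f 0; first by rewrite mul0r msize0.
have [->|g0] := eqVneq g 0; first by rewrite mulr0 msize0.
rewrite msizeM //; have := leq_add fd ge; rewrite addSn addnS.
by case: (_ + _)%N.
Qed.

Lemma msizeX_bound f d k :
  (msize f <= d.+1)%N -> (msize (f ^+ k) <= (d * k).+1)%N.
Proof.
move=> fd; elim: k => [|k IHk]; first by rewrite expr0 msize1.
by rewrite exprS mulnS; apply: msizeM_bound.
Qed.

Lemma msize_seq_monomial d D a m : (forall x, x \in a -> (msize x <= d.+1)%N) ->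
  m \in boxes D (size a) -> (msize (seq_monomial a m) <= (d * D * size a).+1)%N.
Proof.
elim: a m => [|x a IHa] m ad /=; first by rewrite msize1.
case/allpairsP=> -[k m'] /= [kD m'a ->]; rewrite mulnS; apply: msizeM_bound.
  apply: leq_trans (msizeX_bound k (ad x _)) _; first exact: mem_head.
  by rewrite ltnS leq_mul2l ltnW ?orbT //; move: kD; rewrite mem_iota.
by apply: IHa => // y ya; apply: ad; rewrite inE ya orbT.
Qed.

Lemma card_bounded_monomials N : (#|{: 'X_{1..n < N}}| <= N ^ n)%N.
Proof.
have bound (u : 'X_{1..n < N}) i : (u i < N)%N.
  by apply: leq_ltn_trans (bmdeg u); rewrite mdegE (bigD1 i) //= leq_addr.
pose F (u : 'X_{1..n < N}) := [ffun i => Ordinal (bound u i)].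
have <- : #|{ffun 'I_n -> 'I_N}| = (N ^ n)%N by rewrite card_ffun !card_ord.
apply: (leq_card F).
move=> u v /ffunP Fuv; apply/val_inj/mnmP => i.
by have := Fuv i; rewrite !ffunE => /(congr1 val).
Qed.

(** Monomials in r elements with exponents < D are D ^ r in number, and their
    degrees grow linearly in D; for r > n this exceeds the dimension of the
    space of polynomials they lie in when D is large. *)
Lemma algebraic_dependence a : (n < size a)%N ->
  exists D c, box_sum D c a = 0 /\ exists2 m, m \in boxes D (size a) & c m != 0.
Proof.
move=> lt_na; set r := size a in lt_na *.
have [d ad] : exists d, forall x, x \in a -> (msize x <= d.+1)%N.
  exists (\max_(x <- a) msize x) => x xa; rewrite ltnW // ltnS.
  exact: leq_bigmax_seq.
pose M := (d * r).+1; pose D := (M ^ n).+1; pose N := (d * D * r).+1.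
have lt_ND : (N ^ n < D ^ r)%N.
  have le_N : (N <= M * D)%N by rewrite /N /M mulSn mulnAC -add1n leq_add2r.
  have le_Nn : (N ^ n <= (M * D) ^ n)%N.
    by elim: (n) => // k IHk; rewrite !expnS leq_mul.
  rewrite (leq_ltn_trans le_Nn) // expnMn.
  apply: (@leq_trans (D ^ n.+1)); last exact: leq_pexp2l.
  by rewrite expnS ltn_pmul2r // expn_gt0.
have {}lt_ND := leq_ltn_trans (card_bounded_monomials N) lt_ND.
pose mon (i : 'I_(D ^ r)) := nth [::] (boxes D r) i.
have monP i : mon i \in boxes D r by rewrite mem_nth // size_boxes.
pose A : 'M[K]_(D ^ r, #|{: 'X_{1..n < N}}|) :=
  \matrix_(i, j) (seq_monomial a (mon i))@_(bmnm (enum_val j)).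
have kerA : kermx A != 0.
  rewrite -mxrank_eq0 mxrank_ker subn_eq0 -ltnNge.
  exact: leq_ltn_trans (rank_leq_col A) lt_ND.
pose v := nz_row (kermx A).
have v0 : v != 0 by rewrite nz_row_eq0.
have vA : v *m A = 0 by apply/sub_kermxP; exact: nz_row_sub.
pose c m : K := if insub (index m (boxes D r)) is Some i then v 0 i else 0.
have cE i : c (mon i) = v 0 i.
  by rewrite /c /mon index_uniq ?size_boxes ?boxes_uniq // valK.
exists D, c; split; last first.
  have [i vi] : exists i, v 0 i != 0.
    apply/existsP; rewrite -negb_forall; apply: contra v0 => /forallP vi.
    by apply/eqP/rowP=> i; rewrite mxE; apply/eqP.
  by exists (mon i); rewrite ?cE.
have sumE : box_sum D c a = \sum_i v 0 i *: seq_monomial a (mon i).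
  rewrite /box_sum -/r (big_nth [::]) size_boxes big_mkord.
  by apply: eq_bigr => i _; rewrite -cE.
rewrite sumE; apply/mpolyP=> u; rewrite mcoeff0 raddf_sum /=.
have [lt_uN|le_Nu] := ltnP (mdeg u) N; last first.
  rewrite big1 // => i _; rewrite mcoeffZ memN_msupp_eq0 ?mulr0 //.
  apply/msize_mdeg_ge/(leq_trans _ le_Nu).
  exact: msize_seq_monomial.
have /matrixP/(_ 0 (enum_rank (BMultinom lt_uN))) := vA.
rewrite !mxE => {2}<-; apply: eq_bigr => i _.
by rewrite mcoeffZ mxE enum_rankK.
Qed.

(** Elements of C_(i+1) outside C_i, one for each i < r, are algebraically
    independent over K, so there are at most n of them. *)
Lemma prime_chain_length r (P : set {mpoly K[n]}) : prime_chain r P -> (r <= n)%N.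
Proof.
case=> C [Cpr Cstrict _]; rewrite leqNgt; apply/negP => lt_nr.
have step i : exists x, (i < r)%N -> C i.+1 x /\ ~ C i x.
  case: (ltnP i r) => [/Cstrict[_ NC]|]; last by exists 0.
  apply: contrapT => Nx; apply: NC => x Cx; apply: contrapT => Cix.
  by apply: Nx; exists x.
have [x xP] := choice step.
have sz : size (mkseq x r) = r by rewrite size_mkseq.
have [|D [c [c0 [m mD]]]] := algebraic_dependence (a := mkseq x r).
  by rewrite sz.
rewrite (prime_chain_independent (C := C) _ _ _ mD) ?eqxx ?sz //.
  move=> i lt_ir; rewrite nth_mkseq //; have [? ?] := xP i lt_ir.
  by split=> //; case: (Cstrict _ lt_ir).
rewrite c0; apply: ideal_zero; exact/prime_ideal/Cpr.
Qed.

End Dimension.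

(** * Primes generated by variables *)

Section VariablePrimes.
Context {n : nat} {K : fieldType}.
Implicit Types (A B : {set 'I_n}) (f g a : {mpoly K[n]}) (I P : set {mpoly K[n]}).
Implicit Types (u w : 'X_{1..n}).

Definition kill_vars A : {mpoly K[n]} -> {mpoly K[n]} :=
  mmap (@mpolyC n K) (fun i => if i \in A then 0 else 'X_i).

(** The ideal generated by the variables indexed by A, presented as the kernel
    of a substitution so that it is visibly prime. *)
Definition var_ideal A : set {mpoly K[n]} := [set f | kill_vars A f = 0].

Lemma kill_varsX A w :
  kill_vars A 'X_[w] = if [exists i in A, w i != 0%N] then 0 else 'X_[w].
Proof.
rewrite /kill_vars mmapX /mmap1; case: ifPn => [/exists_inP[i iA wi]|].
  by rewrite (bigD1 i) //= iA expr0n (negbTE wi) mul0r.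
rewrite negb_exists => /forallP wA; rewrite mpolyXE_id; apply: eq_bigr => i _.
case: ifP => // iA; have := wA i; rewrite iA negbK => /eqP->.
by rewrite !expr0.
Qed.

Lemma mcoeff_kill_vars A f w :
  (kill_vars A f)@_w = if [exists i in A, w i != 0%N] then 0 else f@_w.
Proof.
have -> : kill_vars A f = \sum_(u <- msupp f) f@_u *: kill_vars A 'X_[u].
  rewrite {1}[f]mpolyE /kill_vars raddf_sum /=; apply: eq_bigr => u _.
  by rewrite mmapZ mul_mpolyC.
rewrite raddf_sum /=; case: ifPn => wA.
  rewrite big1 // => u _; rewrite kill_varsX mcoeffZ.
  case: ifPn => uA; rewrite ?mcoeff0 ?mulr0 // mcoeffX.
  by case: eqP => [uw|_]; rewrite ?mulr0 // -uw (negbTE uA) in wA *.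
rewrite [X in _ = mcoeff w X]mpolyE raddf_sum /=; apply: eq_bigr => u _.
rewrite kill_varsX !mcoeffZ; case: ifPn => uA //; rewrite mcoeff0 mcoeffX.
by case: eqP => [uw|//]; rewrite -uw uA in wA.
Qed.

Lemma var_ideal_prime A : is_prime (var_ideal A).
Proof.
apply/is_primeP; split.
- split=> [|a u v]; rewrite /var_ideal /kill_vars /= ?raddf0 //.
  by move=> u0 v0; rewrite rmorphD rmorphM /= u0 v0 mulr0 addr0.
- by rewrite /var_ideal /kill_vars /= rmorph1 => /eqP; rewrite oner_eq0.
- move=> u v; rewrite /var_ideal /kill_vars /= rmorphM /= => /eqP.
  by rewrite mulf_eq0 => /orP[]/eqP; [left|right].
Qed.

Lemma var_idealX A i : var_ideal A 'X_i <-> i \in A.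
Proof.
rewrite /var_ideal /= kill_varsX; case: ifPn => [/exists_inP[j jA]|].
  by rewrite mnm1E; have [->|] := eqVneq i j; rewrite ?jA.
rewrite negb_exists => /forallP /(_ i); rewrite mnm1E eqxx andbT => iA.
by split=> [/eqP|iA']; [rewrite -msupp_eq0 msuppX | rewrite iA' in iA].
Qed.

Lemma var_ideal_sub A I : is_ideal I -> (forall i, i \in A -> I 'X_i) ->
  var_ideal A `<=` I.
Proof.
move=> Iid IA f fA; rewrite [f]mpolyE; apply: ideal_sum => // w wf.
have : (kill_vars A f)@_w = 0 by rewrite fA mcoeff0.
rewrite mcoeff_kill_vars; case: ifPn => [/exists_inP[i iA wi] _|_ /eqP]; last first.
  by rewrite mcoeff_eq0 wf.
have /submK <- : (U_(i) <= w)%MM by rewrite lep1mP.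
rewrite mpolyXD -mul_mpolyC mulrA; apply: ideal_mull => //; exact: IA.
Qed.

Lemma prime_chain_extend r P Q : prime_chain r P -> is_prime Q -> P `<` Q ->
  @prime_chain {mpoly K[n]} r.+1 Q.
Proof.
case=> C [Cpr Cstrict <-] Qpr CQ.
exists (fun i => if (i <= r)%N then C i else Q); split=> [i _|i|].
- by case: ifP => // /Cpr.
- rewrite /= ltnS (leq_eqVlt i) => /orP[/eqP->|lt_ir].
    by rewrite eqxx ltnn.
  by rewrite lt_ir orbT; apply: Cstrict.
- by rewrite ltnn.
Qed.

(** Adjoining the variables of B outside A one at a time lengthens the chain by
    one prime each. *)
Lemma prime_chain_var_ideal r A B : A \subset B -> prime_chain r (var_ideal A) ->
  prime_chain (r + #|B :\: A|) (var_ideal B).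
Proof.
move kE: #|B :\: A| => k; elim: k r A kE => [|k IHk] r A kE AB rA.
  have /eqP -> : B == A.
    by rewrite finset.eqEsubset AB andbT -finset.setD_eq0 -cards_eq0 kE.
  by rewrite addn0.
have /card_gt0P[i] : (0 < #|B :\: A|)%N by rewrite kE.
rewrite inE => /andP[iA iB]; rewrite addnS -addSn; apply: (IHk _ (i |: A)).
- move: kE; rewrite (cardsD1 i) !inE iA iB => -[<-].
  by rewrite finset.setDDl finset.setUC.
- by rewrite finset.subUset finset.sub1set iB.
apply: (prime_chain_extend rA); first exact: var_ideal_prime.
split.
  apply: var_ideal_sub; first exact/prime_ideal/var_ideal_prime.
  by move=> j jA; apply/var_idealX; rewrite in_setU1 jA orbT.
move/(_ 'X_i); rewrite !var_idealX in_setU1 eqxx => /(_ isT).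
by rewrite (negbTE iA).
Qed.

Lemma supremum_nat_eq (G : set nat) k : G k -> (forall j, G j -> (j <= k)%N) ->
  supremum 0%N G = k.
Proof.
move=> Gk kub; have ksup : supremums G k.
  by split=> [j /kub|j /(_ _ Gk)//]; rewrite leEnat.
rewrite /supremum; case: eqP => [G0|_]; first by rewrite G0 in Gk.
case: xgetP => [j _ jsup|/(_ k)//].
exact: (is_subset1_supremums jsup ksup).
Qed.

(** A chain below the ideal of the variables in A extends by the remaining
    variables to a chain in the whole ring, so it has length at most #|A|. *)
Lemma prime_height_var_ideal A : prime_height (var_ideal A) = #|A|.
Proof.
apply: supremum_nat_eq => [|r rA] /=.
  have := @prime_chain_var_ideal 0 finset.set0 A (finset.sub0set A).
  rewrite finset.setD0 add0n; apply.
  by exists (fun=> var_ideal finset.set0); split=> // i _; exact: var_ideal_prime.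
have /prime_chain_length := prime_chain_var_ideal (finset.subsetT A) rA.
rewrite finset.setTD -(leq_add2l #|A|) addnCA.
have -> : (#|A| + #|~: A|)%N = n by rewrite cardsC card_ord.
by rewrite leq_add2r.
Qed.

Lemma prime_height_le P : is_prime P -> (prime_height P <= n)%N.
Proof.
move=> Ppr; have c0 : prime_chain 0 P by exists (fun=> P); split.
have exm : exists r, `[< prime_chain r P >] by exists 0%N; apply/asboolP.
have ub r : `[< prime_chain r P >] -> (r <= n)%N.
  by move/asboolP; exact: prime_chain_length.
case: (ex_maxnP exm ub) => r /asboolP rP rmax.
rewrite /prime_height (@supremum_nat_eq _ r) //.
  exact: prime_chain_length rP.
by move=> j jP; apply/rmax/asboolP.
Qed.

(** * Monomial ideals *)

Lemma monomial_ideal_support I f : is_monomial_ideal I ->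
  I f <-> forall w, w \in msupp f -> I 'X_[w].
Proof.
case=> M IE; have Iid : is_ideal I by rewrite IE; exact: ideal_gen_ideal.
split=> [If|If]; last first.
  rewrite [f]mpolyE; apply: ideal_sum => // w /If Iw.
  by rewrite -mul_mpolyC; apply: ideal_mull.
pose J := [set f : {mpoly K[n]} | forall w, w \in msupp f -> I 'X_[K, w]].
suff : J f by [].
rewrite IE in If; apply: ideal_gen_sub If => [|_ [m Mm <-] w].
  split=> [w|a u v Ju Jv w]; first by rewrite msupp0.
  move/msuppD_le; rewrite mem_cat => /orP[|/Jv//].
  case/msuppM_le/allpairsP => -[w1 w2] /= [_ /Ju Iw2 ->].
  by rewrite mpolyXD; apply: ideal_mull.
move/mem_msuppXP <-; rewrite IE; apply: ideal_genI.
by exists m.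
Qed.

(** If 'X_[mlead a] is not in P, then it can be used to multiply f without
    changing the colon ideal, and afterwards the leading term of f, being
    multiplied into I, can be dropped; the number of terms of f decreases. *)
Lemma monomial_colon_mlead I f P a : is_monomial_ideal I -> is_prime P ->
  colon I f = P -> P a -> a != 0 -> P 'X_[mlead a].
Proof.
move=> Imon Ppr IfP Pa a0; apply: contrapT => PX.
have Iid : is_ideal I by case: (Imon) => M ->; exact: ideal_gen_ideal.
have /is_primeP[Pid P1 Pmul] := Ppr.
have [N] := ubnP (size (msupp f)); elim: N f IfP => // N IHN f IfP.
rewrite ltnS => fN.
have f0 : f != 0.
  apply/eqP=> f0; apply: P1; rewrite -IfP /colon /= f0 mulr0.
  exact: ideal_zero.
have IXX : I 'X_[(mlead a + mlead f)].
  have /(monomial_ideal_support _ Imon) : I (a * f) by move: Pa; rewrite -IfP.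
  by apply; rewrite -mleadM // mlead_supp // mulf_neq0.
pose g := f - f@_(mlead f) *: 'X_[mlead f].
apply: (IHN (g * 'X_[mlead a])); last first.
  rewrite (perm_size (msuppMX _ _)) size_map (perm_size (msupp_rem _ _)).
  rewrite size_rem ?mlead_supp //; apply: leq_trans fN.
  by rewrite prednK // lt0n size_eq0 msupp_eq0.
have Ig b : I (b * (g * 'X_[mlead a])) <-> I (b * 'X_[mlead a] * f).
  have Ilt : I (b * ((f@_(mlead f) *: 'X_[mlead f]) * 'X_[mlead a])).
    rewrite -scalerAl -mpolyXD addmC -mul_mpolyC mulrA.
    exact: ideal_mull.
  have -> : b * 'X_[mlead a] * f = b * (g * 'X_[mlead a]) +
      b * ((f@_(mlead f) *: 'X_[mlead f]) * 'X_[mlead a]).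
    by rewrite -mulrDr -mulrDl subrK -mulrA ['X_[_] * f]mulrC.
  split=> [|Isum]; first by move=> ?; apply: ideal_add.
  rewrite -[X in I X](addrK
    (b * ((f@_(mlead f) *: 'X_[mlead f]) * 'X_[mlead a]))).
  exact: ideal_sub.
apply/seteqP; split=> b.
  rewrite /colon /= => /Ig Ib.
  have /Pmul[] // : P (b * 'X_[mlead a]) by rewrite -IfP.
move=> Pb; apply/Ig; have : P (b * 'X_[mlead a]).
  by rewrite mulrC; apply: ideal_mull.
by rewrite -IfP.
Qed.

(** A member of P loses its terms divisible by variables in P when those are set
    to 0; if anything were left, its leading monomial would be in P, and so
    would one of the remaining variables. *)
Lemma monomial_colon_prime I f P : is_monomial_ideal I -> is_prime P ->
  colon I f = P -> exists A, P = var_ideal A.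
Proof.
move=> Imon Ppr IfP; have Pid := prime_ideal Ppr.
pose A := finset (fun i => `[< P 'X_i >]).
have AP i : i \in A <-> P 'X_i.
  by rewrite inE; split=> [/asboolP|?] //; apply/asboolP.
have sub : var_ideal A `<=` P by apply: var_ideal_sub => // i /AP.
exists A; apply/seteqP; split=> // g Pg.
have Pkill : P (kill_vars A g).
  rewrite -[kill_vars A g](subKr g); apply: ideal_sub => //; apply: sub.
  apply/mpolyP=> w; rewrite mcoeff_kill_vars mcoeff0; case: ifPn => // wA.
  by rewrite mcoeffB mcoeff_kill_vars (negbTE wA) subrr.
apply/eqP; apply: contraT => kill0.
have := monomial_colon_mlead Imon Ppr IfP Pkill kill0.
rewrite mpolyXE_id => /(prime_ideal_prod Ppr)[i _].
have := mlead_supp kill0; rewrite mcoeff_msupp mcoeff_kill_vars.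
case: ifPn => [|wA _ PX]; first by rewrite eqxx.
case/existsP: wA; exists i; apply/andP; split.
  by apply/AP; apply: prime_idealX PX.
apply/eqP=> wi0; move: PX; rewrite wi0 expr0.
by case/is_primeP: Ppr.
Qed.

(** The minimum and the maximum are attained because there is an associated
    prime and all heights are at most n. *)
Lemma unmixed_height I P : is_unmixed I -> Ass I P -> prime_height P = ht I.
Proof.
move=> unm AP; pose H := [set prime_height P | P in Ass I].
have HP : H (prime_height P) by exists P.
have Hn k : H k -> (k <= n)%N by case=> Q [Qpr _] <-; exact: prime_height_le.
have [_ /(_ _ HP) hmin] := nat_minP HP.
apply/eqP; rewrite eqn_leq hmin andbT [ht I]unm /bight /nat_max.
have exm : exists k, `[< H k >] by exists (prime_height P); apply/asboolP.
have ub k : `[< H k >] -> (k <= n)%N by move/asboolP/Hn.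
case: (ex_maxnP exm ub) => m /asboolP Hm mmax.
case: xgetP => [k _ [_ kub]|/(_ m) []].
  by have := kub _ HP; rewrite leEnat.
by split=> // j Hj; rewrite leEnat; apply/mmax/asboolP.
Qed.

(** * Frobenius powers of primes generated by variables *)

Section FrobeniusPower.
Variables (q : nat) (pq : [pchar K].-nat q).

(** Modulo the q-th Frobenius power of the ideal P of the variables in A, the
    elements killed by P are the multiples of the monomial with this
    exponent. *)
Definition socle_exponent A : 'X_{1..n} :=
  [multinom if i \in A then q.-1 else 0%N | i < n].

Lemma mdeg_socle_exponent A : mdeg (socle_exponent A) = (q.-1 * #|A|)%N.
Proof.
rewrite mdegE mulnC -sum_nat_const [RHS]big_mkcond /=.
by apply: eq_bigr => i _; rewrite mnmE.
Qed.

(** If b outside P multiplied this monomial into P^[q], then the monomial itself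
    would be in P^[q]; but a Cartier map takes it to 1. *)
Lemma colon_frobenius_power_var_ideal A :
  colon (frobenius_power (var_ideal A) q) 'X_[socle_exponent A] = var_ideal A.
Proof.
have Apr := var_ideal_prime A; have q0 := q_gt0 pq.
apply/seteqP; split; last first.
  apply: var_ideal_sub => [|i iA].
    exact/colon_ideal/frobenius_power_ideal.
  rewrite /colon /= -mpolyXD.
  have /submK <- : (U_(i) *+ q <= U_(i) + socle_exponent A)%MM.
    apply/mnm_lepP => j; rewrite mulmnE mnmDE mnm1E mnmE.
    by case: eqP => [<-|_]; rewrite ?iA ?mul1n ?add1n ?prednK.
  rewrite mpolyXD -mpolyXn; apply: ideal_mull; first exact: frobenius_power_ideal.
  by apply: frobenius_powerI; apply/var_idealX.
move=> b; rewrite /colon /= => Ab; apply: contrapT => NAb.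
have {}Ab := prime_frobenius_power_regular pq Apr NAb Ab.
have V0 : power_subspace q [set 0 : K].
  by split=> // a x y -> ->; rewrite mulr0 addr0.
have V1 : ~ [set 0 : K] 1 by move/eqP; rewrite oner_eq0.
have [phi [phiL _ phi1]] := root_linear_separate pq V0 V1.
pose u := socle_exponent A.
have uq i : (u i < q)%N by rewrite mnmE; case: ifP => _ //; rewrite ltn_predL.
have := frobenius_power_cartier pq (prime_ideal Apr) phiL uq Ab.
rewrite -[X in cartier q _ _ X]scale1r cartierZX // phi1 scale1r.
have -> : u == [multinom (u i %% q)%N | i < n].
  by apply/eqP/mnmP=> i; rewrite mnmE modn_small.
have -> : [multinom (u i %/ q)%N | i < n] = 0%MM.
  by apply/mnmP=> i; rewrite mnmE mnm0E divn_small.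
by rewrite mpolyX0; case/is_primeP: Apr.
Qed.

(** If the exponent were smaller, multiplying by the variable would merely move
    the coordinate of f to the next basis monomial. *)
Lemma cartier_exponent_max I f (phi : K -> K) (m : 'X_{1..n}) i : is_ideal I ->
  root_linear q phi -> (forall j, (m j < q)%N) ->
  frobenius_power I q ('X_i * f) -> ~ I (cartier q phi m f) ->
  m i = q.-1.
Proof.
move=> Iid phiL mq If NI; have phi0 := root_linear0 phiL.
have [lt_mi|lt_mi|//] := ltngtP (m i) q.-1; last first.
  by have := mq i; rewrite -(prednK (q_gt0 pq)) ltnS leqNgt lt_mi.
have mq' j : ((m + U_(i))%MM j < q)%N.
  rewrite mnmDE mnm1E; case: eqP => [<-|_]; last by rewrite addn0.
  by rewrite addn1 -(prednK (q_gt0 pq)) ltnS.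
case: NI; have := frobenius_power_cartier pq Iid phiL mq' If.
congr (I _); apply/mpolyP=> w; rewrite !mcoeff_cartier //.
by rewrite addmA addmC mulrC mcoeffMX.
Qed.

End FrobeniusPower.
End VariablePrimes.

(** * The v-number of Frobenius powers *)

Section VNumber.
Context {n : nat} {K : fieldType}.
Implicit Types (f g h : {mpoly K[n]}) (I J P : set {mpoly K[n]}).

Lemma colonM J f g : colon J (f * g) = colon (colon J f) g.
Proof.
by apply/seteqP; split=> a; rewrite /colon /= -mulrA [g * f]mulrC.
Qed.

Lemma prime_colon_proper I f P : is_ideal I -> is_prime P -> colon I f = P ->
  ~ I f.
Proof.
by move=> Iid /is_primeP[_ P1 _] IfP If; apply: P1; rewrite -IfP /colon /= mul1r.
Qed.

Section FrobeniusPower.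
Context {q : nat} (pq : [pchar K].-nat q).

Lemma v_number_frobenius_power_ge I : is_proper_ideal I -> is_graded I ->
  (q * v_number I <= v_number (frobenius_power I q))%N.
Proof.
move=> Ipr Igr; have Iid := proper_ideal_ideal Ipr.
have [||f [fd fpr]] := @v_number_attained n K (frobenius_power I q).
- by apply: frobenius_power_proper => //; exact: q_gt0 pq.
- exact: frobenius_power_graded.
have [phi [m [phiL mq Ig]]] := colon_frobenius_power_prime pq Iid fpr erefl.
have gN0 : cartier q phi m f != 0.
  apply: contra_notN (prime_colon_proper Iid fpr Ig) => /eqP->.
  exact: ideal_zero.
have [d gd ->] := cartier_homog pq phiL fd gN0.
rewrite (leq_trans _ (leq_addr _ _)) // leq_mul2l.
by rewrite (v_number_le gd) ?orbT // Ig.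
Qed.

(** Since P^[q] is P-primary, P is the only prime that can arise. *)
Lemma colon_prime_frobenius_power P f : is_prime P ->
  is_prime (colon (frobenius_power P q) f) ->
  colon (frobenius_power P q) f = P.
Proof.
move=> Ppr fpr; have Jid := frobenius_power_ideal P q.
apply/seteqP; split=> a.
  move=> Paf; apply: contrapT => Pa.
  apply: (prime_colon_proper Jid fpr erefl).
  exact: (prime_frobenius_power_regular pq Ppr Pa Paf).
move=> Pa; apply: (prime_idealX (k := q) fpr).
by rewrite /colon /= mulrC; apply: ideal_mull => //; apply: frobenius_powerI.
Qed.

(** Upper bound: f ^+ q times the socle monomial, where f attains v(I). Lower
    bound: a Cartier image of f with the same prime colon ideal as f comes from
    a basis monomial divisible by the socle monomial. *)
Lemma v_number_frobenius_power_unmixed I :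
  is_proper_ideal I -> is_graded I -> is_unmixed I -> is_monomial_ideal I ->
  v_number (frobenius_power I q) = (q * v_number I + (q - 1) * ht I)%N.
Proof.
move=> Ipr Igr unm Imon; have Iid := proper_ideal_ideal Ipr.
have q0 := q_gt0 pq; have Jid := frobenius_power_ideal I q.
have height A f : colon I f = var_ideal A -> #|A| = ht I.
  move=> IfA; rewrite -(@prime_height_var_ideal n K A).
  apply: unmixed_height => //.
  by split; [exact: var_ideal_prime | exists f].
apply/eqP; rewrite eqn_leq; apply/andP; split.
  have [f [fd fpr]] := v_number_attained Ipr Igr.
  have [A IfA] := monomial_colon_prime Imon fpr erefl.
  apply: (@v_number_le _ _ _ (f ^+ q * 'X_[socle_exponent q A])).
    apply: dhomogM; first by rewrite mulnC; exact: dhomogMn.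
    by rewrite dhomogX subn1 -(height _ _ IfA) /= mdeg_socle_exponent.
  rewrite colonM colon_frobenius_power // IfA colon_frobenius_power_var_ideal //.
  exact: var_ideal_prime.
have [||f [fd fpr]] := @v_number_attained n K (frobenius_power I q).
- exact: frobenius_power_proper.
- exact: frobenius_power_graded.
have [phi [m [phiL mq Ig]]] := colon_frobenius_power_prime pq Iid fpr erefl.
have [A JfA] := monomial_colon_prime Imon fpr Ig.
have gNI := prime_colon_proper Iid fpr Ig.
have gN0 : cartier q phi m f != 0.
  by apply: contra_notN gNI => /eqP->; exact: ideal_zero.
have [d gd ->] := cartier_homog pq phiL fd gN0.
have leA : ((q - 1) * ht I <= mdeg m)%N.
  rewrite -(height A _ (etrans Ig JfA)) mdegE mulnC -sum_nat_const big_mkcond /=.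
  apply: leq_sum => i _; case: ifP => // iA.
  rewrite (cartier_exponent_max pq Iid phiL mq _ gNI (i := i)) ?subn1 //.
  have : var_ideal A ('X_i : {mpoly K[n]}) by apply/var_idealX.
  by rewrite -JfA.
by rewrite leq_add // leq_mul2l (v_number_le gd) ?orbT // Ig.
Qed.

End FrobeniusPower.

(** If P = I : f is associated to I and P^[p] : g = P, then from
    I^[q] : h = P one gets I^[pq] : h^p g = P, since
    I^[pq] : h^p = (I^[q] : h)^[p]. *)
Lemma v_number_frobenius_power_le I p : p \in [pchar K] ->
  is_proper_ideal I -> is_graded I ->
  exists c, forall e, (v_number (frobenius_power I (p ^ e)) <= p ^ e * c)%N.
Proof.
move=> chp Ipr Igr; have Iid := proper_ideal_ideal Ipr.
have pp : [pchar K].-nat p by rewrite pnatE // (pcharf_prime chp).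
have [f [fd Ppr]] := v_number_attained Ipr Igr.
set P := colon I f in Ppr; have Pgr : is_graded P by exact: colon_graded fd.
have [||g [gd gpr]] := @v_number_attained n K (frobenius_power P p).
- by apply: frobenius_power_proper; [case: Ppr | exact: q_gt0 pp].
- by apply: frobenius_power_graded => //; exact: prime_ideal.
have gP := colon_prime_frobenius_power pp Ppr gpr.
set d := v_number (frobenius_power P p) in gd; exists (v_number I + d)%N => e.
suff [h [b [hb hP bd]]] : exists h b, [/\ h \is b.-homog,
    colon (frobenius_power I (p ^ e)) h = P
    & (b + d <= p ^ e * (v_number I + d))%N].
  apply: leq_trans bd; apply: leq_trans (leq_addr _ _).
  by apply: v_number_le hb _; rewrite hP.
elim: e => [|e [h [b [hb hP bd]]]].
  exists f, (v_number I); split=> //; last by rewrite expn0 mul1n.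
  rewrite /P; congr (colon _ _); apply/seteqP; split.
    exact: frobenius_power_sub.
  by move=> a Ia; have := frobenius_powerI 1 Ia.
exists (h ^+ p * g), (b * p + d)%N; split.
- by apply: dhomogM => //; exact: dhomogMn.
- rewrite expnSr -(@frobenius_power_comp _ p); last exact: pchar_mpoly_nat.
  by rewrite colonM colon_frobenius_power ?hP //; exact: frobenius_power_ideal.
- rewrite expnS -mulnA; apply: leq_trans (leq_mul (leqnn p) bd).
  rewrite mulnDr mulnC -addnA leq_add2l addnn -mul2n leq_mul2r.
  by rewrite (prime_gt1 (pcharf_prime chp)) orbT.
Qed.

End VNumber.

Theorem theorem2 (R : realType) (K : fieldType) (p n : nat)
    (I : set {mpoly K[n]}) :
  p \in [pchar K] ->
  is_proper_ideal I ->
  is_graded I ->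
  let v_frob (e : nat) : nat := v_number (frobenius_power I (p ^ e)%N) in
  let v_ratio : R ^nat := fun e => (v_frob e)%:R / (p ^ e)%N%:R in
  [/\ (forall e : nat, (p ^ e * v_number I <= v_frob e)%N)
        /\ nondecreasing_seq v_ratio,
      exists l : R, v_ratio @ \oo --> l
    & is_unmixed I -> is_monomial_ideal I ->
      forall e : nat,
        v_frob e = (p ^ e * v_number I + (p ^ e - 1) * ht I)%N].
Proof.
move=> chp Ipr Igr v_frob v_ratio; have Iid := proper_ideal_ideal Ipr.
have p_pr := pcharf_prime chp; have p0 := prime_gt0 p_pr.
have pq e : [pchar K].-nat (p ^ e)%N by rewrite pnatX pnatE // chp.
have pp : [pchar K].-nat p by rewrite pnatE.
have pe0 e : 0 < (p ^ e)%N%:R :> R by rewrite ltr0n expn_gt0 p0.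
have nd : nondecreasing_seq v_ratio.
  apply/nondecreasing_seqP => e; rewrite /v_ratio ler_pdivrMr // mulrAC.
  rewrite ler_pdivlMr // -!natrM ler_nat expnS mulnA leq_mul2r; apply/orP; right.
  rewrite mulnC /v_frob expnSr -(@frobenius_power_comp _ p);
    last exact: pchar_mpoly_nat.
  apply: v_number_frobenius_power_ge => //.
    by apply: frobenius_power_proper => //; rewrite expn_gt0 p0.
  exact: frobenius_power_graded.
split.
- by split=> // e; exact: v_number_frobenius_power_ge.
- have [c vc] := v_number_frobenius_power_le chp Ipr Igr.
  apply/cvg_ex; apply: nondecreasing_is_cvgn => //; exists c%:R => _ [e _ <-].
  rewrite /v_ratio ler_pdivrMr // -natrM ler_nat mulnC; exact: vc.
- by move=> unm Imon e; exact: v_number_frobenius_power_unmixed.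
Qed.
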